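(* Let $q=2^s$ with $s\geq 2$ and let $m\geq 1$. The Hilbert ideal $\mathfrak{h}_{mV}(O_2^+(\mathbb{F}_q))$, i.e. the ideal of $\mathbb{F}_q[mV]=\mathbb{F}_q[x_1,\dots,x_m,y_1,\dots,y_m]$ generated by all homogeneous $O_2^+(\mathbb{F}_q)$-invariants of positive degree, is generated by $\mathcal{N}\cup\mathcal{U}\cup\mathcal{B}$, where $$\mathcal{N}=\{x_iy_i\mid 1\leq i\leq m\},\quad \mathcal{U}=\{x_iy_j+x_jy_i\mid 1\leq i<j\leq m\},$$ $$\mathcal{B}=\{x_1^{\alpha_1}\cdots x_m^{\alpha_m}+y_1^{\alpha_1}\cdots y_m^{\alpha_m}\mid \alpha\in\mathbb{N}^m,\ \alpha_1+\cdots+\alpha_m=q-1\}.$$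
   Context: $O_2^+(\mathbb{F}_q)\subset\mathrm{GL}_2(\mathbb{F}_q)$ is the group generated by $\sigma=\begin{pmatrix}0&1\\1&0\end{pmatrix}$ and $\tau_a=\begin{pmatrix}a&0\\0&a^{-1}\end{pmatrix}$, $a\in\mathbb{F}_q^\times$. It acts on $\mathbb{F}_q[mV]$ by algebra automorphisms $\sigma(x_i)=y_i$, $\sigma(y_i)=x_i$, $\tau_a(x_i)=a^{-1}x_i$, $\tau_a(y_i)=ay_i$ for $1\leq i\leq m$. $\mathbb{N}=\{0,1,2,\dots\}$. *)

(* Defs.v *)
From HB Require Import structures.
From mathcomp Require Import all_boot all_order all_algebra all_fingroup.
From mathcomp Require Import mpoly.

Set Implicit Arguments.
Unset Strict Implicit.
Unset Printing Implicit Defensive.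

Import GRing.Theory.
Local Open Scope ring_scope.

Section Ideal.
Variable R : comNzRingType.
Implicit Types (S : R -> Prop) (p : R).

Definition ideal_gen S p : Prop :=
  exists2 s : seq (R * R),
    (forall c, c \in s -> S c.2) & p = \sum_(c <- s) c.1 * c.2.

End Ideal.

Section O2plus.
Variable F : finFieldType.

Definition sigma_mx : 'M[F]_2 := \matrix_(i, j) (i != j)%:R.

Definition tau_mx (a : F) : 'M[F]_2 :=
  \matrix_(i, j) (if i != j then 0 else if i == 0 then a else a^-1).

Lemma sigma_mxK : sigma_mx * sigma_mx = 1.
Proof.
apply/matrixP=> i j; rewrite !mxE big_ord_recl big_ord1 !mxE.
by move: i j; do 2!case=> [[|[|//]] ?] //=;
  rewrite ?(mulr0, mul0r, mulr1, addr0, add0r).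
Qed.

Lemma tau_mxV (a : {unit F}) :
  tau_mx (FinRing.uval a) * tau_mx (FinRing.uval a)^-1 = 1.
Proof.
have a0 : FinRing.uval a != 0 by rewrite -unitfE; exact: (valP a).
apply/matrixP=> i j; rewrite !mxE big_ord_recl big_ord1 !mxE.
by move: i j; do 2!case=> [[|[|//]] ?] //=;
  rewrite ?(invrK, mulr0, mul0r, addr0, add0r) ?divff ?mulVf.
Qed.

Lemma sigma_unit : sigma_mx \is a GRing.unit.
Proof. by apply/unitrP; exists sigma_mx; rewrite sigma_mxK. Qed.

Lemma tau_unit (a : {unit F}) : tau_mx (FinRing.uval a) \is a GRing.unit.
Proof. by have /mulmx1_unit[] := tau_mxV a. Qed.

Definition sigma : {'GL_2[F]} := FinRing.Unit sigma_unit.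

Definition tau (a : {unit F}) : {'GL_2[F]} := FinRing.Unit (tau_unit a).

Definition O2plus : {group {'GL_2[F]}} :=
  <<sigma |: [set tau a | a : {unit F}]>>%G.

End O2plus.

Section Hilbert.
Variables (F : finFieldType) (m : nat).
Local Notation P := {mpoly F[m + m]}.
Implicit Types (f p : P) (g h : {'GL_2[F]}).

Definition xv (i : 'I_m) : P := 'X_(lshift m i).
Definition yv (i : 'I_m) : P := 'X_(rshift m i).

(* (x_i, y_i) are the coordinate functions on the i-th copy of V, so that
   (g f)(v) = f (g^-1 v). *)
Definition act g f : P :=
  let h := GLval g^-1 in
  f \mPo [tuple match split k with
                | inl i => h 0 0 *: xv i + h 0 1 *: yv i
                | inr i => h 1 0 *: xv i + h 1 1 *: yv i
                end | k < m + m].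

Definition invariant (G : {group {'GL_2[F]}}) f : Prop :=
  forall g, g \in G -> act g f = f.

Definition hilbert_gens (G : {group {'GL_2[F]}}) f : Prop :=
  exists d : nat, [/\ (0 < d)%N, f \is d.-homog & invariant G f].

Definition hilbert_ideal (G : {group {'GL_2[F]}}) : P -> Prop :=
  ideal_gen (hilbert_gens G).

Definition Ngen p : Prop := exists i : 'I_m, p = xv i * yv i.

Definition Ugen p : Prop :=
  exists i j : 'I_m, (i < j)%N /\ p = xv i * yv j + xv j * yv i.

Definition Bgen (q : nat) p : Prop :=
  exists2 alpha : 'X_{1..m}, mdeg alpha = (q - 1)%N
    & p = \prod_(i < m) xv i ^+ alpha i + \prod_(i < m) yv i ^+ alpha i.

Lemma act_x g i :
  act g (xv i) = GLval g^-1 0 0 *: xv i + GLval g^-1 0 1 *: yv i.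
Proof.
by rewrite /act comp_mpolyXU -tnth_nth tnth_mktuple (unsplitK (inl i)).
Qed.

Lemma act_y g i :
  act g (yv i) = GLval g^-1 1 0 *: xv i + GLval g^-1 1 1 *: yv i.
Proof.
by rewrite /act comp_mpolyXU -tnth_nth tnth_mktuple (unsplitK (inr i)).
Qed.

Lemma GLval_sigmaV : GLval (sigma F)^-1 = sigma_mx F.
Proof.
have /(canRL (mulKr (sigma_unit F))) : sigma_mx F * sigma_mx F = 1
  by exact: sigma_mxK.
by rewrite mulr1 => /esym.
Qed.

Lemma GLval_tauV (a : {unit F}) :
  GLval (tau a)^-1 = tau_mx (FinRing.uval a)^-1.
Proof.
have /(canRL (mulKr (tau_unit a))) := tau_mxV a.
by rewrite mulr1 => ->.
Qed.

Lemma act_sigma_x i : act (sigma F) (xv i) = yv i.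
Proof. by rewrite act_x GLval_sigmaV !mxE scale0r scale1r add0r. Qed.

Lemma act_sigma_y i : act (sigma F) (yv i) = xv i.
Proof. by rewrite act_y GLval_sigmaV !mxE scale0r scale1r addr0. Qed.

Lemma act_tau_x (a : {unit F}) i :
  act (tau a) (xv i) = (FinRing.uval a)^-1 *: xv i.
Proof. by rewrite act_x GLval_tauV !mxE scale0r addr0. Qed.

Lemma act_tau_y (a : {unit F}) i :
  act (tau a) (yv i) = FinRing.uval a *: yv i.
Proof. by rewrite act_y GLval_tauV !mxE scale0r add0r invrK. Qed.

Lemma act_is_monoid_morphism g : monoid_morphism (act g).
Proof. by split=> [|p p']; rewrite /act ?rmorph1 ?rmorphM. Qed.

Lemma act_is_linear g : linear (act g).
Proof. by move=> c p p'; rewrite /act linearP. Qed.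

Lemma actM g h f : act (g * h)%g f = act g (act h f).
Proof.
have act_prod k (n : 'I_k -> nat) (v : 'I_k -> P) g' :
    act g' (\prod_i v i ^+ n i) = \prod_i act g' (v i) ^+ n i.
  have [act1 actMr] := act_is_monoid_morphism g'.
  rewrite (big_morph (act g') actMr act1); apply: eq_bigr => i _.
  by elim: (n i) => [|e IHe]; rewrite ?expr0 ?exprS ?actMr ?IHe.
have actZ g' c f' : act g' (c *: f') = c *: act g' f' by rewrite /act linearZ.
have actD g' f1 f2 : act g' (f1 + f2) = act g' f1 + act g' f2.
  by rewrite /act linearD.
have act_sum g' (r : seq 'X_{1..m + m}) (v : 'X_{1..m + m} -> P) :
    act g' (\sum_(a <- r) v a) = \sum_(a <- r) act g' (v a).
  by rewrite /act linear_sum.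
have gV i j : GLval (g * h)^-1 i j =
    GLval h^-1 i 0 * GLval g^-1 0 j + GLval h^-1 i 1 * GLval g^-1 1 j.
  have l1 : lift ord0 ord0 = 1 :> 'I_2 by apply: val_inj.
  by rewrite invMg GL_MxE mxE big_ord_recl big_ord1 l1.
have actX k : act (g * h)%g 'X_k = act g (act h 'X_k).
  case: (split k) (splitK k) => i <- /=.
    rewrite !act_x actD !actZ act_x act_y !gV.
    by rewrite !scalerDr !scalerA !scalerDl addrACA.
  rewrite !act_y actD !actZ act_x act_y !gV.
  by rewrite !scalerDr !scalerA !scalerDl addrACA.
rewrite (mpolyE f) (act_sum (g * h)%g) (act_sum h) (act_sum g).
apply: eq_bigr => a _; rewrite !actZ (mpolyXE_id _ a) !act_prod.
by congr (_ *: _); apply: eq_bigr => k _; apply: (congr1 (fun u => u ^+ a k) (actX k)).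
Qed.

End Hilbert.

(* Main.v *)
From mathcomp Require Import all_boot all_order all_algebra all_fingroup.
From mathcomp Require Import cyclic finfield zify.
From mathcomp Require Import mpoly.
Require Import Defs.

Set Implicit Arguments.
Unset Strict Implicit.
Unset Printing Implicit Defensive.

Import Order.TTheory GRing.Theory.
Local Open Scope ring_scope.

(** Write x^al y^be for a monomial and I for the ideal generated by the three
    families, over a field of characteristic 2.

    The given polynomials are visibly invariant under sigma and the torus, and
    homogeneous of positive degree ([NUBgen_hilbert]).  For the converse, all
    that happens in an invariant is visible on monomials.  The torus is cyclic
    of order q - 1, so a monomial of an invariant satisfies
    |al| = |be| mod q - 1 ([invariant_weight]), and sigma makes the
    coefficients symmetric under the exchange of al and be.  An invariant is
    therefore a combination of orbit sums x^al y^be + x^be y^al with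
    |al| = |be| mod q - 1, and of fixed monomials x^al y^al; the latter are
    divisible by some x_i y_i in positive degree.

    It remains to see that x^al y^be and x^be y^al agree modulo I, since signs
    do not matter.  The relations x_i y_j = x_j y_i let indices be exchanged
    between the x-part and the y-part, so that modulo I a monomial depends only
    on al + be and |al| ([congr_exchange]).  The relations x^c = y^c for
    |c| = q - 1 move q - 1 units of degree from the y-part to the x-part
    without changing al + be ([congr_shift]).  So a monomial depends only on
    al + be and on |al| mod q - 1 ([congr_shiftn]), and these two data are the
    same for x^al y^be and x^be y^al ([congr_swap]). *)

(** * Generated ideals and congruences *)

Section IdealGen.
Variable R : comNzRingType.
Implicit Types (S T : R -> Prop) (a p : R).

Lemma ideal_gen_mem S p : S p -> ideal_gen S p.
Proof.
move=> Sp; exists [:: (1, p)]; last by rewrite big_seq1 mul1r.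
by move=> c; rewrite inE => /eqP->.
Qed.

Lemma ideal_gen0 S : ideal_gen S 0.
Proof. by exists [::]; rewrite ?big_nil. Qed.

Lemma ideal_genD S p p' :
  ideal_gen S p -> ideal_gen S p' -> ideal_gen S (p + p').
Proof.
move=> [s Ss ->] [s' Ss' ->]; exists (s ++ s'); last by rewrite big_cat.
by move=> c; rewrite mem_cat => /orP[/Ss|/Ss'].
Qed.

Lemma ideal_genMl S a p : ideal_gen S p -> ideal_gen S (a * p).
Proof.
move=> [s Ss ->]; exists [seq (a * c.1, c.2) | c <- s].
  by move=> _ /mapP[c cs ->]; exact: (Ss _ cs).
by rewrite big_map mulr_sumr; apply: eq_bigr => c _; rewrite mulrA.
Qed.

Lemma ideal_genN S p : ideal_gen S p -> ideal_gen S (- p).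
Proof. by rewrite -mulN1r; apply: ideal_genMl. Qed.

Lemma ideal_gen_sum S (I : eqType) (r : seq I) (Q : pred I) (G : I -> R) :
    (forall i, i \in r -> Q i -> ideal_gen S (G i)) ->
  ideal_gen S (\sum_(i <- r | Q i) G i).
Proof.
move=> SG; rewrite big_seq_cond; apply: (big_ind (ideal_gen S)).
- exact: ideal_gen0.
- by move=> p p'; apply: ideal_genD.
- by move=> i /andP[]; apply: SG.
Qed.

Lemma ideal_gen_sub S T p :
  (forall c, S c -> ideal_gen T c) -> ideal_gen S p -> ideal_gen T p.
Proof.
move=> sST [s Ss ->]; apply: ideal_gen_sum => c cs _.
by apply/ideal_genMl/sST/Ss.
Qed.

Definition congr_ideal S p p' := ideal_gen S (p - p').

Lemma congr_ideal_refl S p : congr_ideal S p p.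
Proof. by rewrite /congr_ideal subrr; apply: ideal_gen0. Qed.

Lemma congr_ideal_sym S p p' : congr_ideal S p p' -> congr_ideal S p' p.
Proof. by move/ideal_genN; rewrite opprB. Qed.

Lemma congr_ideal_trans S p1 p2 p3 :
  congr_ideal S p1 p2 -> congr_ideal S p2 p3 -> congr_ideal S p1 p3.
Proof. by move=> h12 h23; have := ideal_genD h12 h23; rewrite addrA subrK. Qed.

Lemma congr_idealMl S a p p' :
  congr_ideal S p p' -> congr_ideal S (a * p) (a * p').
Proof. by rewrite /congr_ideal -mulrBr; apply: ideal_genMl. Qed.

(** Splitting a sum into orbits of an involution.  Averaging over the
    involution would divide by 2, so instead a total order picks one element
    of each two-element orbit. *)
Lemma ideal_gen_sum_involution S disp (I : orderType disp) (r : seq I)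
    (w : I -> I) (G : I -> R) :
    involutive w -> uniq r -> (forall i, i \in r -> w i \in r) ->
    (forall i, i \in r -> w i = i -> ideal_gen S (G i)) ->
    (forall i, i \in r -> ideal_gen S (G i + G (w i))) ->
  ideal_gen S (\sum_(i <- r) G i).
Proof.
move=> wK r_uniq rw Gfix Gpair.
have w_perm : perm_eq (map w r) r.
  apply: uniq_perm => //; first by rewrite (map_inj_uniq (inv_inj wK)).
  move=> i; apply/mapP/idP => [[j /rw ? ->] //|ir].
  by exists (w i); rewrite ?wK // rw.
rewrite (bigID (fun i => w i == i)) /=; apply: ideal_genD.
  by apply: ideal_gen_sum => i ir /eqP; apply: Gfix.
rewrite (bigID (fun i => (i < w i)%O)) /=.
have -> : \sum_(i <- r | (w i != i) && ~~ (i < w i)%O) G i =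
          \sum_(i <- r | (w i != i) && (i < w i)%O) G (w i).
  rewrite -(perm_big _ w_perm) big_map; apply: eq_bigl => i; rewrite wK.
  by rewrite eq_sym; case: ltgtP.
by rewrite -big_split /=; apply: ideal_gen_sum => i ir _; apply: Gpair.
Qed.

End IdealGen.

(** * Bihomogeneous monomials *)

Section Monomials.
Variables (F : finFieldType) (m : nat).
Local Notation P := {mpoly F[m + m]}.
Implicit Types (al be : 'X_{1..m}) (M : 'X_{1..m + m}) (f : P).

Definition xmon al : P := \prod_(i < m) xv F i ^+ al i.
Definition ymon be : P := \prod_(i < m) yv F i ^+ be i.

Lemma xmonD al be : xmon (al + be)%MM = xmon al * xmon be.
Proof. by rewrite -big_split; apply: eq_bigr => i _; rewrite mnmDE exprD. Qed.

Lemma ymonD al be : ymon (al + be)%MM = ymon al * ymon be.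
Proof. by rewrite -big_split; apply: eq_bigr => i _; rewrite mnmDE exprD. Qed.

Lemma xmon1 i : xmon U_(i)%MM = xv F i.
Proof.
rewrite /xmon (bigD1 i) //= big1 => [|j ji].
  by rewrite mnm1E eqxx expr1 mulr1.
by rewrite mnm1E eq_sym (negbTE ji) expr0.
Qed.

Lemma ymon1 i : ymon U_(i)%MM = yv F i.
Proof.
rewrite /ymon (bigD1 i) //= big1 => [|j ji].
  by rewrite mnm1E eqxx expr1 mulr1.
by rewrite mnm1E eq_sym (negbTE ji) expr0.
Qed.

Definition xpart M : 'X_{1..m} := [multinom M (lshift m i) | i < m].
Definition ypart M : 'X_{1..m} := [multinom M (rshift m i) | i < m].

Definition swap M : 'X_{1..m + m} :=
  [multinom match split k with
            | inl i => M (rshift m i)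
            | inr i => M (lshift m i)
            end | k < m + m].

Lemma xpart_swap M : xpart (swap M) = ypart M.
Proof. by apply/mnmP=> i; rewrite !mnmE (unsplitK (inl i)). Qed.

Lemma ypart_swap M : ypart (swap M) = xpart M.
Proof. by apply/mnmP=> i; rewrite !mnmE (unsplitK (inr i)). Qed.

Lemma part_inj M M' : xpart M = xpart M' -> ypart M = ypart M' -> M = M'.
Proof.
move=> /mnmP hx /mnmP hy; apply/mnmP=> k.
by case: (split_ordP k) => i ->; [have := hx i | have := hy i]; rewrite !mnmE.
Qed.

Lemma swapK : involutive swap.
Proof.
move=> M; apply: part_inj; first by rewrite xpart_swap ypart_swap.
by rewrite ypart_swap xpart_swap.
Qed.

Lemma mpolyX_parts M : 'X_[M] = xmon (xpart M) * ymon (ypart M).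
Proof.
rewrite mpolyXE_id big_split_ord.
by congr (_ * _); apply: eq_bigr => i _; rewrite mnmE.
Qed.

Lemma mdeg_parts M : mdeg M = (mdeg (xpart M) + mdeg (ypart M))%N.
Proof.
rewrite !mdegE big_split_ord.
by congr (_ + _)%N; apply: eq_bigr => i _; rewrite mnmE.
Qed.

Lemma dhomog_xmon al : xmon al \is (mdeg al).-homog.
Proof.
rewrite /xmon mprodXnE dhomogX /= mdeg_sum mdegE.
by apply/eqP; apply: eq_bigr => i _; rewrite mdegMn mdeg1 mul1n.
Qed.

Lemma dhomog_ymon be : ymon be \is (mdeg be).-homog.
Proof.
rewrite /ymon mprodXnE dhomogX /= mdeg_sum mdegE.
by apply/eqP; apply: eq_bigr => i _; rewrite mdegMn mdeg1 mul1n.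
Qed.

(** * The action of the generators *)

Lemma act_monomial g al be :
  act g (xmon al * ymon be) =
  \prod_(i < m) act g (xv F i) ^+ al i * \prod_(i < m) act g (yv F i) ^+ be i.
Proof.
rewrite /act rmorphM /= !rmorph_prod /=.
by congr (_ * _); apply: eq_bigr => i _; rewrite rmorphXn.
Qed.

Lemma act_sigma_monomial al be :
  act (sigma F) (xmon al * ymon be) = xmon be * ymon al.
Proof.
rewrite act_monomial mulrC.
by congr (_ * _); apply: eq_bigr => i _; rewrite ?act_sigma_x ?act_sigma_y.
Qed.

Lemma act_tau_monomial (a : {unit F}) al be :
  act (tau a) (xmon al * ymon be) =
  (FinRing.uval a ^- mdeg al * FinRing.uval a ^+ mdeg be)
    *: (xmon al * ymon be).
Proof.
rewrite act_monomial.
have prodZ (c : F) (v : 'I_m -> P) (n : 'X_{1..m}) :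
    \prod_i (c *: v i) ^+ n i = c ^+ mdeg n *: \prod_i v i ^+ n i.
  by rewrite mdegE -prodrXr -scaler_prod; apply: eq_bigr => i _; rewrite exprZn.
under eq_bigr => i _ do rewrite act_tau_x.
under [X in _ * X]eq_bigr => i _ do rewrite act_tau_y.
by rewrite !prodZ exprVn -scalerAl -scalerAr scalerA.
Qed.

(** The coefficients of the image of f under a linear map that permutes the
    monomials up to scalars, as sigma and the torus do. *)
Lemma mcoeff_sum_monomial f (G : 'X_{1..m + m} -> P)
    (w : 'X_{1..m + m} -> 'X_{1..m + m}) (c : 'X_{1..m + m} -> F) M :
    injective w -> (forall M', G M' = c M' *: 'X_[w M']) ->
  (\sum_(M' <- msupp f) f@_M' *: G M')@_(w M) = f@_M * c M.
Proof.
move=> w_inj Gw; rewrite raddf_sum /=.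
under eq_bigr => M' _ do rewrite Gw !mcoeffZ mcoeffX (inj_eq w_inj).
have [Mf|Mf] := boolP (M \in msupp f).
  rewrite (bigD1_seq M) ?msupp_uniq //= eqxx mulr1.
  rewrite big1 ?addr0 // => M' /negbTE->.
  by rewrite !mulr0.
rewrite big_seq big1 => [|M' M'f]; first by rewrite memN_msupp_eq0 ?mul0r.
by case: eqP M'f Mf => [->->//|_ _ _]; rewrite !mulr0.
Qed.

Lemma actE g f : act g f = \sum_(M <- msupp f) f@_M *: act g 'X_[M].
Proof.
rewrite {1}(mpolyE f) /act linear_sum.
by apply: eq_bigr => M _; rewrite linearZ.
Qed.

Lemma mcoeff_act_sigma f M : (act (sigma F) f)@_(swap M) = f@_M.
Proof.
rewrite actE (@mcoeff_sum_monomial _ _ _ (fun=> 1)) ?mulr1 //.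
  exact: inv_inj swapK.
move=> M'; rewrite !mpolyX_parts act_sigma_monomial xpart_swap ypart_swap.
by rewrite scale1r.
Qed.

Lemma mcoeff_act_tau (a : {unit F}) f M :
  (act (tau a) f)@_M =
  f@_M * (FinRing.uval a ^- mdeg (xpart M) * FinRing.uval a ^+ mdeg (ypart M)).
Proof.
pose c M' := FinRing.uval a ^- mdeg (xpart M')
             * FinRing.uval a ^+ mdeg (ypart M').
rewrite actE -{1}[M]/(id M) (@mcoeff_sum_monomial _ _ id c) //.
by move=> M'; rewrite !mpolyX_parts act_tau_monomial.
Qed.

Lemma invariant_gens f :
  act (sigma F) f = f -> (forall a, act (tau a) f = f) ->
  invariant (O2plus F) f.
Proof.
move=> fs ft g /gen_prodgP[n [c cP ->]].
(* sigma has order 2, so the identity acts trivially on f because sigma does. *)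
have sigma2 : (sigma F * sigma F = 1)%g by apply: val_inj; apply: sigma_mxK.
apply: (big_ind (fun h => act h f = f)).
- by rewrite -sigma2 actM !fs.
- by move=> h h' hf h'f; rewrite actM h'f.
- by move=> i _; case/setU1P: (cP i) => [->|/imsetP[a _ ->]].
Qed.

(** The units of F form a cyclic group; comparing coefficients for a generator
    a of it gives a ^ |xpart| = a ^ |ypart|, hence a congruence of the exponents
    modulo the order of a. *)
Lemma invariant_weight f M :
    (forall a, act (tau a) f = f) -> M \in msupp f ->
  mdeg (xpart M) = mdeg (ypart M) %[mod #|F|.-1].
Proof.
move=> ft; rewrite mcoeff_msupp => fM.
have /cyclicP[a aE] := field_unit_group_cyclic [set: {unit F}]%G.
have a_ord : #[a]%g = #|F|.-1 by rewrite -card_finField_unit aE.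
apply/eqP; rewrite -a_ord -eq_expg_mod_order; apply/eqP/val_inj.
rewrite !FinRing.val_unitX.
have := congr1 (mcoeff M) (ft a); rewrite mcoeff_act_tau.
move/eqP; rewrite -subr_eq0 -{2}[f@_M]mulr1 -mulrBr mulf_eq0 (negbTE fM).
rewrite subr_eq0.
have a0 : FinRing.uval a ^+ mdeg (xpart M) != 0.
  by rewrite expf_neq0 // -unitfE; apply: (valP a).
by move=> /eqP /(canRL (mulVKf a0)); rewrite mulr1.
Qed.

End Monomials.

(** * Splitting exponent vectors *)

Lemma mnm_pos_split n (al : 'X_{1..n}) i :
  (0 < al i)%N -> exists al0, al = (U_(i) + al0)%MM.
Proof.
move=> ali; exists (al - U_(i))%MM; rewrite addmC submK //.
by rewrite lep1mP -lt0n.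
Qed.

Lemma mdeg_pos_split n (al : 'X_{1..n}) :
  (0 < mdeg al)%N -> exists i al0, al = (U_(i) + al0)%MM.
Proof.
move=> al_gt0; have [i ali|al0] := pickP (fun i => 0 < al i)%N.
  by exists i; apply: mnm_pos_split.
move: al_gt0; rewrite mdegE big1 // => i _.
by apply/eqP; rewrite eqn0Ngt al0.
Qed.

Lemma mdeg_split n (be : 'X_{1..n}) d :
  (d <= mdeg be)%N -> exists c be', be = (c + be')%MM /\ mdeg c = d.
Proof.
elim: d => [|d IHd] led; first by exists 0%MM, be; rewrite add0m mdeg0.
have [c [be' [bE cd]]] := IHd (ltnW led).
have [|i [be0 b'E]] := @mdeg_pos_split _ be'.
  by move: led; rewrite bE mdegD cd -addn1 leq_add2l.
exists (c + U_(i))%MM, be0; rewrite mdegD mdeg1 cd addn1; split=> //.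
by rewrite bE b'E addmA.
Qed.

(** * Monomials modulo the generators *)

Section Generators.
Variables (F : finFieldType) (m q : nat).
Local Notation P := {mpoly F[m + m]}.
Hypothesis F2 : (2 \in [pchar F])%N.
Implicit Types (al be : 'X_{1..m}) (f p : P).

Definition NUBgen f := Ngen f \/ Ugen f \/ Bgen q f.
Local Notation "p == p' %[mod_NUB]" := (congr_ideal NUBgen p p')
  (at level 70, p' at next level).

Lemma mpoly_oppr_char2 p : - p = p.
Proof.
apply/eqP; rewrite eq_sym -addr_eq0 -[p]scale1r -scalerDl.
by rewrite -[1 + 1]/(2%:R) (pcharf0 F2) scale0r.
Qed.

Lemma xv_yvC i j : xv F i * yv F j == xv F j * yv F i %[mod_NUB].
Proof.
rewrite /congr_ideal mpoly_oppr_char2.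
case: (ltngtP i j) => [ij|ji|/val_inj->].
- by apply: ideal_gen_mem; right; left; exists i, j.
- by rewrite addrC; apply: ideal_gen_mem; right; left; exists j, i.
- by rewrite -{2}[_ * _]mpoly_oppr_char2 subrr; apply: ideal_gen0.
Qed.

(** If the two x-parts share a variable x_i, it factors out and induction on the
    degree applies.  Otherwise i occurs in the second y-part, and one relation
    x_i y_j = x_j y_i brings it into the second x-part. *)
Lemma congr_exchange al be al' be' :
    (al + be = al' + be')%MM -> mdeg al = mdeg al' ->
  xmon F al * ymon F be == xmon F al' * ymon F be' %[mod_NUB].
Proof.
have [n] := ubnP (mdeg al); elim: n al be al' be' => // n IHn al be al' be'.
move=> le_n abE dE; have [al0|al_gt0] := posnP (mdeg al).
  move: dE abE; rewrite al0 => /esym/eqP; move/eqP: al0.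
  rewrite !mdeg_eq0 => /eqP-> /eqP->; rewrite !add0m => ->.
  exact: congr_ideal_refl.
have [i [al1 alE]] := mdeg_pos_split al_gt0; subst al.
have same_i al2 be2 : (al1 + be = al2 + be2)%MM -> mdeg al1 = mdeg al2 ->
    xmon F (U_(i) + al1) * ymon F be
      == xmon F (U_(i) + al2) * ymon F be2 %[mod_NUB].
  move=> abE2 dE2; rewrite !xmonD -!mulrA; apply: congr_idealMl.
  by apply: IHn => //; move: le_n; rewrite mdegD mdeg1.
have [al'i|al'i] := posnP (al' i); last first.
  have [al2 al'E] := mnm_pos_split al'i; subst al'.
  apply: same_i; last by move: dE; rewrite !mdegD => /addnI.
  apply/mnmP=> k; have /mnmP/(_ k) := abE; rewrite !mnmDE; lia.
have [|j [al2 al'E]] := @mdeg_pos_split _ al'; first by rewrite -dE.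
have [|be2 be'E] := @mnm_pos_split _ be' i.
  have /mnmP/(_ i) := abE; rewrite !mnmDE mnm1E eqxx al'i /=; lia.
subst al' be'.
apply: (@congr_ideal_trans _ _ _ (xmon F (U_(i) + al2) * ymon F (U_(j) + be2))).
  apply: same_i; last by move: dE; rewrite !mdegD !mdeg1 => /addnI.
  apply/mnmP=> k; have /mnmP/(_ k) := abE; rewrite !mnmDE; lia.
rewrite !xmonD !ymonD !xmon1 !ymon1.
rewrite ![_ * xmon F al2]mulrC ![_ * ymon F be2]mulrC.
have AC (a b c d : P) : a * b * (c * d) = a * c * (b * d) by rewrite mulrACA.
by rewrite (AC _ (xv F i)) (AC _ (xv F j)); apply/congr_idealMl/xv_yvC.
Qed.

Lemma congr_shift al be c : mdeg c = (q - 1)%N ->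
  xmon F al * ymon F (c + be) == xmon F (al + c) * ymon F be %[mod_NUB].
Proof.
move=> cd; rewrite xmonD ymonD [ymon F c * _]mulrC -mulrA [xmon F c * _]mulrC.
do 2!apply: congr_idealMl.
rewrite /congr_ideal mpoly_oppr_char2 addrC; apply: ideal_gen_mem.
by right; right; exists c.
Qed.

Lemma congr_shiftn k al be al' be' :
    (al + be = al' + be')%MM -> mdeg al' = (mdeg al + k * (q - 1))%N ->
  xmon F al * ymon F be == xmon F al' * ymon F be' %[mod_NUB].
Proof.
elim: k al be => [|k IHk] al be abE dE.
  by apply: congr_exchange; rewrite // dE mul0n addn0.
have abd : (mdeg al + mdeg be = mdeg al' + mdeg be')%N by rewrite -!mdegD abE.
have [|c [be1 [bE cd]]] := @mdeg_split _ be (q - 1).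
  move: abd; rewrite dE mulSn; move: (mdeg al) (mdeg be) (k * _)%N.
  by lia.
rewrite bE; apply: congr_ideal_trans (congr_shift _ _ cd) _.
apply: IHk; first by rewrite -addmA -bE.
by rewrite dE mdegD cd mulSn addnA.
Qed.

(** The two sides have the same exponent sum, and their x-degrees |al| and |be|
    differ by a multiple of q - 1. *)
Lemma congr_swap al be : mdeg al = mdeg be %[mod q - 1] ->
  xmon F al * ymon F be == xmon F be * ymon F al %[mod_NUB].
Proof.
wlog le_ab : al be / (mdeg al <= mdeg be)%N => [ih|] abd.
  have [le_ab|/ltnW le_ba] := leqP (mdeg al) (mdeg be); first exact: ih.
  by apply: congr_ideal_sym; apply: ih.
have /dvdnP[k kE] : (q - 1 %| mdeg be - mdeg al)%N.
  by rewrite -eqn_mod_dvd //; apply/eqP.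
by apply: (@congr_shiftn k); rewrite -?kE ?subnKC // addmC.
Qed.

Lemma xmon_ymon_ideal al :
  (0 < mdeg al)%N -> ideal_gen NUBgen (xmon F al * ymon F al).
Proof.
case/mdeg_pos_split=> i [al0 ->]; rewrite xmonD ymonD xmon1 ymon1 mulrACA mulrC.
by apply/ideal_genMl/ideal_gen_mem; left; exists i.
Qed.

(** * Comparison of the two ideals *)

Lemma hilbert_gens_sub f :
  #|F| = q -> hilbert_gens (O2plus F) f -> ideal_gen NUBgen f.
Proof.
move=> hF [d [d_gt0 /dhomogP f_homog f_inv]].
have fs : act (sigma F) f = f.
  by apply/f_inv/mem_gen/setU1P; left.
have ft a : act (tau a) f = f.
  by apply/f_inv/mem_gen/setU1P; right; apply: imset_f.
have f_swap M : f@_(swap M) = f@_M by rewrite -{1}fs mcoeff_act_sigma.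
rewrite (mpolyE f); apply: (ideal_gen_sum_involution (@swapK m)).
- exact: msupp_uniq.
- by move=> M; rewrite !mcoeff_msupp f_swap.
(* A monomial fixed by sigma is x^al y^al, with al nonzero since d > 0. *)
- move=> M Mf swapM; rewrite -mul_mpolyC; apply: ideal_genMl.
  have xyM : ypart M = xpart M by rewrite -xpart_swap swapM.
  rewrite mpolyX_parts xyM; apply: xmon_ymon_ideal.
  have := d_gt0; rewrite -(f_homog _ Mf) /= mdeg_parts xyM.
  by rewrite addnn double_gt0.
move=> M Mf; rewrite f_swap -scalerDr -mul_mpolyC; apply: ideal_genMl.
rewrite !mpolyX_parts xpart_swap ypart_swap -[X in _ + X]mpoly_oppr_char2.
apply: congr_swap; rewrite subn1 -hF; exact: invariant_weight.
Qed.

Lemma NUBgen_hilbert f : #|F| = q -> NUBgen f -> hilbert_gens (O2plus F) f.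
Proof.
have act_mono g : monoid_morphism (@act F m g) := act_is_monoid_morphism m g.
have actDg g (p1 p2 : P) : act g (p1 + p2) = act g p1 + act g p2.
  by rewrite /act linearD.
have actMg g (p1 p2 : P) : act g (p1 * p2) = act g p1 * act g p2.
  by case: (act_mono g).
have unit_neq0 (a : {unit F}) : FinRing.uval a != 0.
  by rewrite -unitfE; apply: (valP a).
move=> hF [[i ->]|[[i [j [ij ->]]]|[al al_d ->]]].
- exists 2; split=> //.
    by rewrite (@dhomogM _ _ _ 1 _ 1) ?dhomogX /= ?mdeg1.
  apply: invariant_gens => [|a].
    by rewrite actMg act_sigma_x act_sigma_y mulrC.
  rewrite actMg act_tau_x act_tau_y -scalerAl -scalerAr scalerA mulVf //.
  by rewrite scale1r.
- exists 2; split=> //.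
    by rewrite rpredD // (@dhomogM _ _ _ 1 _ 1) ?dhomogX /= ?mdeg1.
  apply: invariant_gens => [|a].
    rewrite actDg !actMg !act_sigma_x !act_sigma_y.
    by rewrite addrC mulrC [X in _ + X]mulrC.
  rewrite actDg !actMg !act_tau_x !act_tau_y -!scalerAl -!scalerAr !scalerA.
  by rewrite mulVf // !scale1r.
have xE : xmon F al = xmon F al * ymon F 0.
  by rewrite /ymon big1 ?mulr1 // => i; rewrite mnmE.
have yE : ymon F al = xmon F 0 * ymon F al.
  by rewrite /xmon big1 ?mul1r // => i; rewrite mnmE.
rewrite -/(xmon F al) -/(ymon F al).
exists (q - 1)%N; split.
- by rewrite subn_gt0 -hF finNzRing_gt1.
- by rewrite -al_d rpredD ?dhomog_xmon ?dhomog_ymon.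
apply: invariant_gens => [|a].
  by rewrite actDg xE yE !act_sigma_monomial -xE -yE addrC.
rewrite actDg xE yE !act_tau_monomial -xE -yE !mdeg0 al_d.
have aq : FinRing.uval a ^+ (q - 1) = 1.
  apply: (mulfI (unit_neq0 a)); rewrite -exprS subn1 -hF.
  by rewrite prednK ?(ltnW (finNzRing_gt1 F)) // expf_card mulr1.
by rewrite aq expr0 invr1 mulr1 !scale1r.
Qed.

End Generators.

Theorem theorem1p7 (q s m : nat) (F : finFieldType)
    (hs : (2 <= s)%N) (hq : q = (2 ^ s)%N) (hF : #|F| = q) (hm : (1 <= m)%N)
    (p : {mpoly F[m + m]}) :
  hilbert_ideal (O2plus F) p <->
  ideal_gen (fun f : {mpoly F[m + m]} => Ngen f \/ Ugen f \/ Bgen q f) p.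
Proof.
have F2 : 2%N \in [pchar F]%R by apply: (@card_finPcharP F 2 s); rewrite ?hF.
split; apply: ideal_gen_sub => f; first exact: hilbert_gens_sub.
by move=> /(NUBgen_hilbert hF)/ideal_gen_mem.
Qed.
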